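(* Let $(X_n)_{n\ge 0}$ be the self-interacting nearest-neighbour random walk on $\mathbb{Z}$ with $X_0=0$, initial local time profile $L_0\equiv 0$, and transition rule $$P(X_{n+1}=X_n+1\mid X_0,\dots,X_n)=1-P(X_{n+1}=X_n-1\mid X_0,\dots,X_n)=\frac{e^{-\Delta_n/2}}{e^{\Delta_n/2}+e^{-\Delta_n/2}},$$ where $$\Delta_n=\ell_n(-3/2)-\ell_n(-1/2)-\ell_n(1/2)+\ell_n(3/2)$$ and $\ell_n(e)=L_n(X_n+e)$ is the local time profile on edges seen from the walker at time $n$. Then with positive probability $X_n\sim\sqrt{2n}$ as $n\to\infty$, i.e. $$P\Big(\lim_{n\to\infty}\frac{X_n}{\sqrt{2n}}=1\Big)>0.$$
   Context: The set $E$ of unoriented edges of $\mathbb{Z}$ is identified with $\mathbb{Z}+1/2$: the edge $\{x,x+1\}$ corresponds to $x+1/2$. Given an initial profile $L_0:E\to\mathbb{R}$, the local time profile is updated by $L_{n+1}(e)=L_n(e)+1_{\{e=e_{n+1}\}}$, where $e_{n+1}=\{X_n,X_{n+1}\}$ is the edge crossed at the $(n+1)$-th jump. Thus, when $L_0\equiv0$, $L_n(e)$ is the number of times the walk has crossed the edge $e$ (in either direction) during its first $n$ steps. *)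

(* Defs.v *)
From HB Require Import structures.
From mathcomp Require Import all_boot all_order all_algebra.
From mathcomp Require Import all_classical all_reals all_analysis.

Set Implicit Arguments.
Unset Strict Implicit.
Unset Printing Implicit Defensive.

Import Order.TTheory GRing.Theory Num.Theory.
Import numFieldNormedType.Exports.

Local Open Scope classical_set_scope.
Local Open Scope ring_scope.

HB.instance Definition _ := isPointed.Build int 0.

HB.instance Definition _ := @isMeasurable.Build default_measure_display
  int (@discrete_measurable int) (@discrete_measurable0 int)
  (@discrete_measurableC int) (@discrete_measurableU int).

(* The unoriented edge {x, y} is identified with its midpoint.  Profiles are
   total functions on rat, but for nearest-neighbour paths only their values on
   Z + 1/2 are ever updated or consulted. *)
Definition edge (x y : int) : rat := (x%:~R + y%:~R) / 2.

Fixpoint local_time (R : realType) (L0 : rat -> R) (x : nat -> int) (n : nat)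
    : rat -> R :=
  if n is m.+1 then
    fun e => local_time L0 x m e + (e == edge (x m) (x m.+1))%:R
  else L0.

(* Local time profile on edges seen from the walker. *)
Definition seen_local_time (R : realType) (L0 : rat -> R) (x : nat -> int)
    (n : nat) (e : rat) : R :=
  local_time L0 x n ((x n)%:~R + e).

Definition Delta (R : realType) (L0 : rat -> R) (x : nat -> int) (n : nat) : R :=
  let l := seen_local_time L0 x n in
  l (- (3 / 2)) - l (- (1 / 2)) - l (1 / 2) + l (3 / 2).

Definition right_prob (R : realType) (D : R) : R :=
  expR (- D / 2) / (expR (D / 2) + expR (- D / 2)).

(* Y is a version of the conditional probability of A given the sub-sigma-algebra
   G, in the sense of Kolmogorov. *)
Definition is_cond_prob (d : measure_display) (T : measurableType d)
    (R : realType) (P : probability T R) (G : set (set T)) (A : set T)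
    (Y : T -> R) : Prop :=
  [/\ forall B : set R, measurable B -> G (Y @^-1` B),
      P.-integrable setT (EFin \o Y)
    & forall B : set T, G B -> P (A `&` B) = (\int[P]_(w in B) (Y w)%:E)%E].

(* The sigma-algebra generated by X_0, ..., X_n (inclusive). *)
Definition past (d : measure_display) (T : measurableType d) (R : realType)
    (P : probability T R) (X : nat -> {RV P >-> int}) (n : nat) : set (set T) :=
  g_sigma_preimage (fun k : 'I_n.+1 => X k : T -> int).

(* Main.v *)
Require Import Defs.
From mathcomp Require Import all_boot all_order all_algebra.
From mathcomp Require Import all_classical all_reals all_analysis.
From mathcomp Require Import ring lra zify.

Set Implicit Arguments.
Unset Strict Implicit.
Unset Printing Implicit Defensive.

Import Order.TTheory GRing.Theory Num.Theory.
Import numFieldNormedType.Exports.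

Local Open Scope classical_set_scope.
Local Open Scope ring_scope.

(* Let b be the final number of crossings of the edge left of a site y and a that
   of the edge before it.  As long as the edge {y+1, y+2} is fresh, the successive
   visits to y see Delta = a - 1, a - 3, a - 5, and so on, whatever the walker does,
   so the number of left moves from y is a sum of independent indicators; by the
   symmetry of the rule its mean makes E[b] = a + 1 up to exponentially small
   errors.  Hence the final local time at the y-th edge is y + O(y^(3/4)), the site
   y is reached at a time ~ y^2 / 2, and X_n ~ sqrt(2n).
   To get positive probability, the path is followed by a finite description that
   dies as soon as the walk leaves this scenario, and a nonnegative potential that
   is a supermartingale, equals 1 at death and is < 1 after a suitable start: the
   survival probability from then on is at least 1 minus the potential. *)

(** * The transition probability and its sums over a symmetric window of drifts *)

Lemma right_prob_gt0 (R : realType) (D : R) : 0 < right_prob D.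
Proof. by rewrite /right_prob divr_gt0 ?addr_gt0 ?expR_gt0. Qed.

Lemma right_probN (R : realType) (D : R) : right_prob (- D) = 1 - right_prob D.
Proof.
rewrite /right_prob opprK mulNr.
have h1 := expR_gt0 (D / 2); have h2 := expR_gt0 (- (D / 2)).
have h3 : expR (D / 2) + expR (- (D / 2)) != 0 by rewrite gt_eqF// addr_gt0.
by field; rewrite ?h3 // addrC h3.
Qed.

Lemma right_prob_le1 (R : realType) (D : R) : right_prob D <= 1.
Proof. by have := right_prob_gt0 (- D); rewrite right_probN; lra. Qed.

Lemma right_prob_le_exp (R : realType) (D : R) : right_prob D <= expR (- D).
Proof.
rewrite /right_prob ler_pdivrMr ?addr_gt0 ?expR_gt0// mulrDr -!expRD.
have -> : - D + D / 2 = - D / 2 by field.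
by rewrite lerDl expR_ge0.
Qed.

(** The visit followed by [j] others of the window has drift [2 * (j - m)]: this is the expected
    number of left moves in the last [r] visits, and [window_var] is the variance of that number. *)
Definition window_mean (R : realType) (m r : nat) : R :=
  \sum_(j < r) right_prob (2 * (m%:R - j%:R)).

Definition window_var (R : realType) (m r : nat) : R :=
  \sum_(j < r) right_prob (2 * (m%:R - j%:R)) * right_prob (2 * (j%:R - m%:R)).

(** Reversing the order of the visits negates the drifts, so opposite terms add up to 1. *)
Lemma window_mean_full (R : realType) (m : nat) :
  window_mean R m m.*2.+1 = m%:R + 1 / 2.
Proof.
suff : window_mean R m m.*2.+1 *+ 2 = m.*2.+1%:R.
  by rewrite -addn1 natrD -muln2 natrM mulr2n; lra.
rewrite mulr2n {2}/window_mean (reindex_inj rev_ord_inj)/= -big_split/=.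
rewrite (eq_bigr (fun=> 1)) ?sumr_const ?card_ord// => j _.
have -> : 2 * (m%:R - (m.*2.+1 - j.+1)%:R) = - (2 * (m%:R - j%:R)) :> R.
  have jm : (j <= m.*2)%N by rewrite -ltnS.
  have m2 : m.*2%:R = 2 * m%:R :> R by rewrite -muln2 natrM mulrC.
  by rewrite subSS natrB// m2; ring.
by rewrite right_probN; ring.
Qed.

Lemma geometric_third_le (R : realType) (n : nat) :
  \sum_(j < n) expR (- (2 * j%:R)) <= 3 / 2 :> R.
Proof.
have e3 : expR (- 2) <= 3^-1 :> R.
  by rewrite expRN lef_pV2 ?posrE ?expR_gt0//; have := expR_ge1Dx (2 : R); lra.
(* The closed form of the geometric partial sum makes the bound inductive. *)
suff : \sum_(j < n) expR (- (2 * j%:R)) <= 3 / 2 * (1 - 3^-1 ^+ n) :> R.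
  by have : 0 <= 3^-1 ^+ n :> R by [rewrite exprn_ge0]; lra.
elim: n => [|n IH]; first by rewrite big_ord0 expr0 subrr mulr0.
have en : expR (- (2 * n%:R)) <= 3^-1 ^+ n :> R.
  by rewrite -mulNr expRM_natr lerXn2r ?nnegrE ?expR_ge0 ?invr_ge0.
by rewrite big_ord_recr/= exprS; lra.
Qed.

Lemma window_var_ge0 (R : realType) (m r : nat) : 0 <= window_var R m r.
Proof. by apply: sumr_ge0 => j _; rewrite mulr_ge0 ?ltW ?right_prob_gt0. Qed.

(** On either side of drift zero, one factor of each term decays like [exp (- 2 * |m - j|)],
    whatever the length of the window. *)
Lemma window_var_full_le (R : realType) (m : nat) :
  window_var R m m.*2.+1 <= 3.
Proof.
rewrite /window_var -addnn -addSn big_split_ord/=.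
have -> : 3 = 3 / 2 + 3 / 2 :> R by field.
apply: lerD.
  rewrite (reindex_inj rev_ord_inj)/=.
  apply: le_trans (geometric_third_le R m.+1); apply: ler_sum => j _.
  have jm : (j <= m)%N by rewrite -ltnS.
  have -> : expR (- (2 * j%:R)) = expR (- (2 * j%:R)) * 1 :> R by rewrite mulr1.
  apply: ler_pM; rewrite ?(ltW (right_prob_gt0 _)) ?right_prob_le1//.
  have -> : 2 * (m%:R - (m.+1 - j.+1)%:R) = 2 * j%:R :> R.
    by rewrite subSS natrB//; ring.
  exact: right_prob_le_exp.
apply: le_trans (geometric_third_le R m); apply: ler_sum => j _.
have -> : expR (- (2 * j%:R)) = 1 * expR (- (2 * j%:R)) :> R by rewrite mul1r.
apply: ler_pM; rewrite ?(ltW (right_prob_gt0 _)) ?right_prob_le1//.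
apply: le_trans (right_prob_le_exp _) _; rewrite ler_expR lerN2.
by rewrite natrD -addn1 natrD; lra.
Qed.

(** * A finite description of the walk around its frontier *)

Variant side := Lft | Mid | Rgt.

(* [Live k y s z a b c]: up to a fixed shift of Z, the walker is at y - 1, y, y + 1
   according to k; the edges {y-3, y-2}, {y-2, y-1}, {y-1, y}, {y, y+1} have been
   crossed z, a, b, c times, the edges beyond never, and those up to {y-2, y-1}
   s times in total (they are not crossed again). *)
Variant state :=
  | Dead
  | Live of side & nat & nat & nat & nat & nat & nat.

Definition alive (st : state) : bool := if st is Dead then false else true.

(* With m = halfwin y, phase y starts at y with b = a - 2m and c = 0, i.e. drift 2m,
   and y may be left to the left only while the drift is >= -2m.  Since each visit
   to y lowers the drift by 2, there are 2m + 1 such visits, whose drifts are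
   symmetric about 0. *)
Definition halfwin (y : nat) : nat := (y %/ 16)%N.

(** The condition [|a - y| <= y^(3/4)], squared. *)
Definition near (R : realType) (y a : nat) : bool :=
  (a%:R - y%:R) ^+ 2 <= Num.sqrt y%:R ^+ 3 :> R.

(** Seen from [y + 1] the drift is [b - c]. When it has come down to [2 * halfwin y.+1], the window
    of [y + 1] opens and the labels shift by one site; [b] is then final, so [near] is tested
    here. *)
Definition enter_right (R : realType) (y s z a b c : nat) : state :=
  if b == (c + (halfwin y.+1).*2)%N then
    if near R y.+1 b then Live Mid y.+1 (s + b) a b c 0 else Dead
  else Live Rgt y s z a b c.

Definition step (R : realType) (st : state) (right : bool) : state :=
  match st with
  | Dead => Dead
  | Live Lft y s z a b c => if right then Live Mid y s z a b.+1 c else Dead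
  | Live Mid y s z a b c =>
      if right then enter_right R y s z a b c.+1
      else if (b + c <= a + (halfwin y).*2)%N then Live Lft y s z a b.+1 c
      else Dead
  | Live Rgt y s z a b c => if right then Dead else Live Mid y s z a b c.+1
  end.

Definition drift (R : realType) (st : state) : R :=
  match st with
  | Dead => 0
  | Live Lft y s z a b c => z%:R - a%:R - b%:R + c%:R
  | Live Mid y s z a b c => a%:R - b%:R - c%:R
  | Live Rgt y s z a b c => b%:R - c%:R
  end.

(** The constant comes from the end of [failure_bound_le], which needs [32 <= y / 2^20]. *)
Definition large (R : realType) (y : nat) : Prop := 2 ^+ 25 <= y%:R :> R.

(** The parities record on which side of each edge the walker stands. The lower bounds on [b] in
    terms of [c] say that the window of [y + 1] has not opened yet. *)
Definition consistent (R : realType) (st : state) : Prop :=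
  if st is Live k y s z a b c then
    [/\ large R y, near R y a, (16 * z <= 17 * y)%N, odd a &
      [/\ (a <= b + (halfwin y).*2)%N, (b <= a + (halfwin y).*2 + 2)%N &
      match k with
      | Lft => [/\ ~~ odd b, ~~ odd c, (b + c <= a + (halfwin y).*2 + 1)%N
                & (c + (halfwin y.+1).*2 + 1 <= b)%N]
      | Mid => [/\ odd b, ~~ odd c & (c + (halfwin y.+1).*2 + 1 <= b)%N]
      | Rgt => [/\ odd b, odd c & (c + (halfwin y.+1).*2 + 2 <= b)%N]
      end]]
  else True.

Lemma large_nat (R : realType) (y : nat) : large R y -> (1000 <= y)%N.
Proof.
rewrite /large => H; rewrite -(ler_nat R); apply: le_trans H.
apply: (@le_trans _ _ (2 ^+ 10)); last by rewrite ler_weXn2l// ler1n.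
by rewrite !exprS expr0; lra.
Qed.

Lemma sqr_le_bounds (R : realType) (x c : R) :
  0 <= c -> x ^+ 2 <= c ^+ 2 -> - c <= x <= c.
Proof.
by move=> c0; rewrite -ler_norml -[x ^+ 2]real_normK ?num_real// ler_pXn2r ?nnegrE.
Qed.

(** Once [sqrt y >= 256], the deviation [y^(3/4)] is at most [y / 16]; later comparisons become
    linear. *)
Lemma near_bounds (R : realType) (y a : nat) :
  large R y -> near R y a -> (15 * y <= 16 * a /\ 16 * a <= 17 * y)%N.
Proof.
rewrite /large /near => ly ny.
pose r : R := Num.sqrt y%:R.
have ry : r ^+ 2 = y%:R by rewrite sqr_sqrtr.
have r256 : 256 <= r.
  rewrite -(@ler_pXn2r _ 2) ?nnegrE ?sqrtr_ge0// ry; apply: le_trans ly.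
  apply: (@le_trans _ _ (2 ^+ 16)); last by rewrite ler_weXn2l// ler1n.
  by rewrite !exprS expr0; lra.
have H : (a%:R - y%:R) ^+ 2 <= (y%:R / 16) ^+ 2 :> R.
  apply: le_trans ny _; rewrite -/r -ry.
  have -> : (r ^+ 2 / 16) ^+ 2 = r ^+ 3 * (r / 256) by field.
  by rewrite ler_peMr ?exprn_ge0//; lra.
have /andP[h1 h2] := sqr_le_bounds (divr_ge0 (ler0n R y) (ler0n R 16)) H.
split; rewrite -(ler_nat R) !natrM; lra.
Qed.

Lemma step_consistent (R : realType) (st : state) (right : bool) :
  consistent R st -> consistent R (step R st right).
Proof.
case: st => // k y s z a b c [ly ny zy oa [ab ba K]].
have y3 := large_nat ly; have [ay ya] := near_bounds ly ny.
have hs : (halfwin y <= halfwin y.+1)%N by rewrite /halfwin leq_div2r.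
have hm : (16 * halfwin y.+1 <= y + 1)%N by rewrite /halfwin; lia.
have ly1 : large R y.+1 by apply: le_trans ly _; rewrite ler_nat.
move: K hs hm; set m := halfwin y; set m' := halfwin y.+1 => K hs hm.
case: k K => [[]|[]|[]]; case: right => //=.
- move=> *; split => //; split; rewrite -/m -/m'; try split; lia.
- move=> *; rewrite /enter_right -/m'; case: eqP => [e|ne].
    case: ifP => // nb; have [by1 yb1] := near_bounds ly1 nb.
    have hm2 : (16 * halfwin y.+2 <= y + 2)%N by rewrite /halfwin; lia.
    move: hm2; set m2 := halfwin _ => hm2.
    by split => //; try lia; split; rewrite -/m' -/m2; try split; lia.
  by split => //; split; rewrite -/m -/m'; try split; lia.
- by move=> *; case: ifP => // h; split => //; split; rewrite -/m -/m'; try split; lia.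
- move=> *; split => //; split; rewrite -/m -/m'; try split; lia.
Qed.

(** * The potential and its supermartingale property *)

(** Bounds the probability of a move against a drift of size at least [2 * halfwin y]; the moves
    that [step] forbids outright are of this kind. *)
Definition failure_bound (R : realType) (y : nat) : R :=
  expR (- (2 * (halfwin y)%:R)).

(* r is the number of visits left in the window and e = b + c.  The square plus the
   variance is the conditional expectation of (b_final - (y+1))^2, exactly a
   martingale; the second term decreases with y fast enough to pay for the variance
   and the failures of the later phases; the last one pays [failure_bound] for each
   move (b + c increases at every move and stays below 8y). *)
Definition pot (R : realType) (y b r e : nat) : R :=
  ((b%:R + 2 * window_mean R (halfwin y) r - y.+1%:R) ^+ 2
     + 4 * window_var R (halfwin y) r) / Num.sqrt y.+1%:R ^+ 3
  + 26 / Num.sqrt y.+1%:R + failure_bound R y * (8 * y%:R - e%:R).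

(** Counts the drifts [a - e], [a - e - 2], and so on down to [- 2 * halfwin y]; truncated
    subtraction gives 0 once the window is over. *)
Definition remaining (y a e : nat) : nat := (a + (halfwin y).*2 + 2 - e)./2.

(** Away from [y], the forced return is already counted in the crossings but not in the last
    argument of [pot]: the difference, one [failure_bound], pays for the risk of that move. *)
Definition potential (R : realType) (st : state) : R :=
  match st with
  | Dead => 1
  | Live Lft y s z a b c => pot R y b.+1 (remaining y a (b.+1 + c)) (b + c)
  | Live Mid y s z a b c => pot R y b (remaining y a (b + c)) (b + c)
  | Live Rgt y s z a b c => pot R y b (remaining y a (b + c.+1)) (b + c)
  end.

Lemma failure_bound_le (R : realType) (y : nat) : large R y ->
  failure_bound R y * (8 * y%:R) <= 1 / Num.sqrt y.+1%:R ^+ 3.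
Proof.
move=> ly; have y3 := large_nat ly.
pose q : R := Num.sqrt y.+1%:R.
have q2 : q ^+ 2 = y.+1%:R by rewrite sqr_sqrtr.
have q1 : 1 <= q.
  by rewrite -(@ler_pXn2r _ 2) ?nnegrE ?sqrtr_ge0// q2 expr1n ler1n.
have yq : y%:R = q ^+ 2 - 1 :> R by rewrite q2 -natr1; ring.
have y1 : 1 <= y%:R :> R by rewrite ler1n; lia.
rewrite -/q ler_pdivlMr ?exprn_gt0//; last by lra.
rewrite /failure_bound expRN -mulrA mulrC [8 * _ * _]mulrC.
rewrite ler_pdivrMr ?expR_gt0// mul1r.
(* Rounding in [halfwin] loses at most 15/16, which the 1 absorbs; the fourth power of this bound
   then beats the [y^3] required. *)
have hm : y%:R / 32 <= 1 + (halfwin y)%:R / 2 :> R.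
  have : (y <= 16 * halfwin y + 15)%N by rewrite /halfwin; lia.
  by rewrite -(ler_nat R) natrD natrM; lra.
have e4 : expR (2 * (halfwin y)%:R) = expR ((halfwin y)%:R / 2) ^+ 4 :> R.
  by rewrite -expRM_natr; congr expR; field.
have : (y%:R / 32) ^+ 4 <= expR (2 * (halfwin y)%:R) :> R.
  rewrite e4 lerXn2r ?nnegrE ?divr_ge0 ?expR_ge0//.
  exact: le_trans hm (expR_ge1Dx _).
apply: le_trans.
have q3 : q ^+ 3 <= (2 * y%:R) ^+ 2.
  apply: (@le_trans _ _ (q ^+ 4)); first by rewrite ler_weXn2l.
  rewrite -[4%N]/(2 * 2)%N exprM q2 lerXn2r ?nnegrE ?mulr_ge0//.
  by rewrite -natr1; lra.
apply: (@le_trans _ _ ((2 * y%:R) ^+ 2 * (8 * y%:R))).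
  by rewrite ler_pM2r// mulr_gt0//; lra.
have -> : (y%:R / 32) ^+ 4 = y%:R ^+ 3 * (y%:R / (2 ^+ 10 * 2 ^+ 10)) :> R by field.
have -> : (2 * y%:R) ^+ 2 * (8 * y%:R) = y%:R ^+ 3 * 32 :> R by ring.
rewrite ler_pM2l ?exprn_gt0//; last by lra.
rewrite ler_pdivlMr ?mulr_gt0 ?exprn_gt0//; apply: le_trans ly.
by rewrite !exprS expr0; lra.
Qed.

(** A full window adds [2 * halfwin y + 1] to [b] on average, which turns the square into
    [(a - y)^2]. What is left is paid by the decrease of the second term from [y] to [y + 1]. *)
Lemma pot_start (R : realType) (y a : nat) : large R y -> near R y a ->
  pot R y (a - (halfwin y).*2) (halfwin y).*2.+1 (a - (halfwin y).*2)
  <= (a%:R - y%:R) ^+ 2 / Num.sqrt y%:R ^+ 3 + 26 / Num.sqrt y%:R.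
Proof.
move=> ly ny; have y3 := large_nat ly; have [ay _] := near_bounds ly ny.
have am : ((halfwin y).*2 <= a)%N by rewrite /halfwin; lia.
have y0 : 0 < y%:R :> R by rewrite ltr0n; lia.
have fb := failure_bound_le ly; have V := window_var_full_le R (halfwin y).
rewrite /pot window_mean_full natrB//.
pose p : R := Num.sqrt y%:R; pose q : R := Num.sqrt y.+1%:R; rewrite -/p -/q in fb *.
have p0 : 0 < p by rewrite sqrtr_gt0.
have pq : p <= q by rewrite ler_sqrt ?ler_nat// ltr0n.
have q0 : 0 < q by apply: lt_le_trans pq.
have qp2 : q ^+ 2 = p ^+ 2 + 1 by rewrite !sqr_sqrtr// -natr1.
set E := failure_bound R y in fb *.
have E0 : 0 <= E * (a%:R - (halfwin y).*2%:R).
  by rewrite mulr_ge0 ?expR_ge0// subr_ge0 ler_nat.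
have -> : a%:R - (halfwin y).*2%:R + 2 * ((halfwin y)%:R + 1 / 2) - y.+1%:R
          = a%:R - y%:R :> R.
  by rewrite -muln2 natrM -natr1; field.
set D2 := (_ - _) ^+ 2.
have hD : D2 / q ^+ 3 <= D2 / p ^+ 3.
  by rewrite ler_wpM2l ?sqr_ge0// lef_pV2 ?posrE ?exprn_gt0// lerXn2r ?nnegrE// ltW.
have hV : 4 * window_var R (halfwin y) (halfwin y).*2.+1 / q ^+ 3 <= 12 / q ^+ 3.
  by rewrite ler_wpM2r ?invr_ge0 ?exprn_ge0 ?(ltW q0)//; lra.
(* 13 is 12 for the variance plus 1 for the failures. Since [q^2 - p^2 = 1],
   [1 / p - 1 / q >= 1 / (2 q^3)], whence the constant 26. *)
have hq : 13 / q ^+ 3 <= 26 / p - 26 / q.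
  have -> : 26 / p - 26 / q = 26 / (p * q * (p + q)).
    have pq0 : p + q != 0 by rewrite gt_eqF ?addr_gt0.
    have one : 1 = q ^+ 2 - p ^+ 2 by rewrite qp2; ring.
    rewrite -[X in _ = X / _]mulr1 one.
    by field; rewrite pq0 !gt_eqF.
  have -> : 13 / q ^+ 3 = 26 / (2 * q ^+ 3) by field; rewrite gt_eqF.
  rewrite ler_pM2l// lef_pV2 ?posrE ?mulr_gt0 ?addr_gt0 ?exprn_gt0//.
  have : p * q <= q ^+ 2 by rewrite expr2 ler_pM2r.
  have -> : 2 * q ^+ 3 = q ^+ 2 * (q + q) by ring.
  by move=> h; rewrite ler_pM ?mulr_ge0 ?addr_ge0 ?(ltW p0) ?(ltW q0)// lerD2r.
rewrite mulrDl mulrBr; move: hV hq fb.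
rewrite -[13 / _]/(13 * _) -[12 / _]/(12 * _) div1r; lra.
Qed.

Lemma pot_le_main (R : realType) (y b r e : nat) : (e <= 8 * y)%N ->
  ((b%:R + 2 * window_mean R (halfwin y) r - y.+1%:R) ^+ 2
     + 4 * window_var R (halfwin y) r) / Num.sqrt y.+1%:R ^+ 3
  + 26 / Num.sqrt y.+1%:R <= pot R y b r e.
Proof.
move=> he; rewrite /pot lerDl mulr_ge0 ?expR_ge0// subr_ge0.
by rewrite -natrM ler_nat.
Qed.

Lemma pot_ge0 (R : realType) (y b r e : nat) : (e <= 8 * y)%N ->
  0 <= pot R y b r e.
Proof.
move=> he; apply: le_trans (pot_le_main R b r he).
apply: addr_ge0; last by rewrite divr_ge0 ?sqrtr_ge0.
rewrite divr_ge0 ?exprn_ge0 ?sqrtr_ge0//.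
by rewrite addr_ge0 ?sqr_ge0// mulr_ge0 ?window_var_ge0.
Qed.

Lemma potS (R : realType) (y b r e : nat) :
  pot R y b r e.+1 = pot R y b r e - failure_bound R y.
Proof. by rewrite /pot -[e.+1%:R]natr1; ring. Qed.

Lemma potential_ge0 (R : realType) (st : state) :
  consistent R st -> 0 <= potential R st.
Proof.
case: st => [|k y s z a b c]; first by rewrite /= ler01.
case=> ly ny zy oa [ab ba K]; have [ay ya] := near_bounds ly ny.
have : (b + c <= 8 * y)%N by move: K; rewrite /halfwin in ba *; case: k => -[]; lia.
by case: k K => K h; apply: pot_ge0.
Qed.

(** At a change of phase no visit remains, so the square is the very quantity that [near] tests: if
    the test fails the potential exceeds 1, and otherwise it matches the bound of [pot_start] for
    the next phase. *)
Lemma potential_enter_right (R : realType) (y s z a b c : nat) :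
  large R y -> near R y a -> odd b -> odd c ->
  (a <= b + (halfwin y).*2)%N -> (b <= a + (halfwin y).*2 + 2)%N ->
  (c.+1 + (halfwin y.+1).*2 <= b + 1)%N ->
  potential R (enter_right R y s z a b c)
    <= pot R y b (remaining y a (b + c.+1)) (b + c).
Proof.
move=> ly ny ob oc ab ba cb; have [ay ya] := near_bounds ly ny.
have y3 := large_nat ly.
have ly1 : large R y.+1 by apply: le_trans ly _; rewrite ler_nat.
rewrite /enter_right; case: eqP => [e|_]//.
have m1 : (16 * halfwin y.+1 <= y + 1)%N by rewrite /halfwin; lia.
have m0 : (16 * halfwin y <= y)%N by rewrite /halfwin; lia.
have r0 : remaining y a (b + c.+1) = 0%N by rewrite /remaining; lia.
have bc : (b + c <= 8 * y)%N by lia.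
rewrite r0; have M := pot_le_main R b 0 bc; apply: le_trans M.
have q0 : 0 < Num.sqrt y.+1%:R :> R by rewrite sqrtr_gt0 ltr0n.
rewrite {1}/window_mean {1}/window_var !big_ord0 !mulr0 !addr0.
case: ifP => nb /=.
  have S := pot_start ly1 nb.
  have ec : c = (b - (halfwin y.+1).*2)%N by lia.
  have [by1 _] := near_bounds ly1 nb.
  have m2 : (16 * halfwin y.+2 <= y + 2)%N by rewrite /halfwin; lia.
  have er : remaining y.+1 b (c + 0) = (halfwin y.+1).*2.+1.
    by rewrite /remaining; lia.
  by rewrite er addn0 ec.
rewrite -[leLHS]addr0 lerD ?divr_ge0 ?sqrtr_ge0//.
rewrite ler_pdivlMr ?exprn_gt0// mul1r ltW// ltNge.
by rewrite -/(near R y.+1 b) nb.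
Qed.

Lemma potential_supermartingale (R : realType) (st : state) :
  consistent R st -> alive st ->
  right_prob (drift R st) * potential R (step R st true)
  + (1 - right_prob (drift R st)) * potential R (step R st false)
    <= potential R st.
Proof.
case: st => // k y s z a b c C _; have C0 := potential_ge0 C.
have C1 := potential_ge0 (step_consistent true C).
case: C => ly ny zy oa [ab ba K]; have [ay ya] := near_bounds ly ny.
have y3 := large_nat ly.
have m0 : (16 * halfwin y <= y)%N by rewrite /halfwin; lia.
have m1 : (halfwin y <= halfwin y.+1)%N by rewrite /halfwin leq_div2r.
set D := drift R _; set p := right_prob D.
have p0 : 0 <= p by apply/ltW/right_prob_gt0.
have p1 : p <= 1 by apply: right_prob_le1.
pose E := failure_bound R y.
(* A forced move: death has probability [v <= E], and its cost is covered by the loss of [E] in the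
   potential. *)
have forced (u v w : R) : 0 <= u -> 0 <= v <= 1 -> v <= E -> u <= w - E ->
    (1 - v) * u + v * 1 <= w.
  by move=> u0 /andP[v0 v1] vE uw; have := mulr_ge0 v0 u0; lra.
have lost_right : D <= - (2 * (halfwin y)%:R) -> 1 - p <= E.
  by move=> h; rewrite -right_probN; apply: le_trans (right_prob_le_exp _) _;
     rewrite opprK ler_expR.
have lost_left : 2 * (halfwin y)%:R <= D -> p <= E.
  by move=> h; apply: le_trans (right_prob_le_exp _) _; rewrite ler_expR lerN2.
have m2 : (halfwin y).*2%:R = 2 * (halfwin y)%:R :> R.
  by rewrite -muln2 natrM mulrC.
case: k @D @p K C0 C1 p0 p1 lost_right lost_left => D p [].
- move=> ob oc hbc hcb C0 C1 p0 p1 lost_right _ /=.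
  rewrite -{1}[p](subKr 1); apply: forced => //.
  + by rewrite subr_ge0 p1 lerBlDr lerDl.
  + apply: lost_right; rewrite /D /=.
    have : (z + c + (halfwin y).*2 <= a + b)%N by lia.
    by rewrite -(ler_nat R) !natrD m2; lra.
  + rewrite -potS; have -> : (b.+1 + c)%N = (b + c).+1 by rewrite addSn.
    exact: lexx.
- move=> ob oc hcb C0 C1 p0 p1 lost_right _.
  have main := @potential_enter_right R y s z a b c.+1 ly ny ob _ ab ba.
  have {}main : potential R (step R (Live Mid y s z a b c) true)
      <= pot R y b (remaining y a (b + c.+2)) (b + c) - E.
    by rewrite -potS -addnS; apply: main => /=; lia.
  rewrite [step R _ false]/=; case: leqP => h.
    (* Inside the window, a left excursion adds 2 to [b] and a right one adds 2 to [c]: both leave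
       [r] visits. *)
    have [r er] : exists r, (a + (halfwin y).*2 = b + c + r.*2)%N.
      by exists ((a + (halfwin y).*2 - (b + c))./2); lia.
    have r1 : remaining y a (b + c.+2) = r by rewrite /remaining; lia.
    have r2 : remaining y a (b.+2 + c) = r by rewrite /remaining; lia.
    have r3 : remaining y a (b + c) = r.+1 by rewrite /remaining; lia.
    move: main; rewrite r1 => main /=; rewrite r2 r3 addSn potS.
    apply: le_trans (_ : p * (pot R y b r (b + c) - E)
        + (1 - p) * (pot R y b.+2 r (b + c) - E) <= _).
      by rewrite lerD2r ler_wpM2l.
    have eD : 2 * ((halfwin y)%:R - r%:R) = - D.
      have : (a + (halfwin y).*2)%:R = (b + c + r.*2)%:R :> R by rewrite er.
      by rewrite /D /= !natrD m2 -muln2 natrM; lra.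
    (* The current visit is the last term of both sums, so square plus variance is balanced exactly
       and only the surplus [E] remains. *)
    rewrite /pot /window_mean /window_var !big_ord_recr/=.
    rewrite -[r%:R - _]opprB mulrN eD opprK right_probN -/p.
    have E0 : 0 <= E by apply: expR_ge0.
    rewrite -/E -[b.+2%:R]natr1 -[b.+1%:R]natr1.
    set S := \sum_(j < r) _; set V := \sum_(j < r) _.
    rewrite -subr_ge0 (_ : _ - _ = E)//; ring.
  rewrite [potential R Dead]/= -{1}[p](subKr 1); apply: forced => //.
  + by rewrite subr_ge0 p1 lerBlDr lerDl.
  + apply: lost_right; rewrite /D /=.
    have : (a + (halfwin y).*2 + 2 <= b + c)%N by lia.
    by rewrite -(ler_nat R) !natrD m2; lra.
  + have r1 : remaining y a (b + c.+2) = 0%N by rewrite /remaining; lia.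
    have r2 : remaining y a (b + c) = 0%N by rewrite /remaining; lia.
    by move: main; rewrite /= r1 r2.
- move=> ob oc hcb C0 C1 p0 p1 _ lost_left.
  rewrite [potential R (step R _ true)]/= addrC; apply: forced => //.
  + apply: (@potential_ge0 R (Live Mid y s z a b c.+1)).
    by split=> //; split=> //; split; lia.
  + by rewrite p0.
  + apply: lost_left; rewrite /D /=.
    have : ((halfwin y).*2 + c <= b)%N by lia.
    by rewrite -(ler_nat R) !natrD m2; lra.
  + by rewrite /= -potS addnS.
Qed.

(** * Agreement of the walk with its description *)

Definition crossings (R : realType) (x : nat -> int) (n : nat) (k : int) : R :=
  local_time (cst 0) x n (k%:~R + 1 / 2).
Arguments crossings : simpl never.

Lemma crossings_right (R : realType) (x : nat -> int) (n : nat) (k : int) :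
  x n.+1 = x n + 1 -> crossings R x n.+1 k = crossings R x n k + (k == x n)%:R.
Proof.
move=> xn; rewrite /crossings /=; congr (_ + _%:R); congr nat_of_bool.
have -> : edge (x n) (x n.+1) = (x n)%:~R + 1 / 2.
  by rewrite /edge xn intrD; field.
by rewrite (inj_eq (addIr _)) eqr_int.
Qed.

Lemma crossings_left (R : realType) (x : nat -> int) (n : nat) (k : int) :
  x n.+1 = x n - 1 ->
  crossings R x n.+1 k = crossings R x n k + (k == x n - 1)%:R.
Proof.
move=> xn; rewrite /crossings /=; congr (_ + _%:R); congr nat_of_bool.
have -> : edge (x n) (x n.+1) = (x n - 1)%:~R + 1 / 2.
  by rewrite /edge xn intrB; field.
by rewrite (inj_eq (addIr _)) eqr_int.
Qed.

Lemma Delta_crossings (R : realType) (x : nat -> int) (n : nat) :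
  Delta (cst 0) x n = crossings R x n (x n - 2) - crossings R x n (x n - 1)
                      - crossings R x n (x n) + crossings R x n (x n + 1).
Proof.
rewrite /Delta /seen_local_time /crossings !intrD.
by congr (_ - _ - _ + _); congr (local_time _ _ _ _); field.
Qed.

Definition offset (k : side) : int :=
  match k with Lft => -1 | Mid => 0 | Rgt => 1 end.

(** The site called [y] is [y + o] in Z. Each step crosses one edge, so time is the total
    [s + b + c]; control of [s] thus becomes control of time. *)
Definition tracks (R : realType) (o : int) (x : nat -> int) (n : nat)
    (st : state) : Prop :=
  if st is Live k y s z a b c then
    let p := y%:Z + o in
    [/\ x n = p + offset k, n = (s + b + c)%N,
        forall j, p < j -> crossings R x n j = 0 &
      [/\ crossings R x n (p - 3) = z%:R, crossings R x n (p - 2) = a%:R,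
          crossings R x n (p - 1) = b%:R & crossings R x n p = c%:R]]
  else True.

Lemma tracks_drift (R : realType) (o : int) (x : nat -> int) (n : nat)
    (st : state) : tracks R o x n st -> alive st ->
  Delta (cst 0) x n = drift R st.
Proof.
case: st => // k y s z a b c [xn _ c0 [cz ca cb cc]] _.
rewrite Delta_crossings xn; set p := _ + o in xn c0 cz ca cb cc *.
case: k xn => xn /=; rewrite /offset.
- have -> : p - 1 - 2 = p - 3 by ring.
  have -> : p - 1 - 1 = p - 2 by ring.
  by rewrite subrK cz ca cb cc.
- by rewrite addr0 ca cb cc c0 ?ltrDl// addr0.
- have -> : p + 1 - 2 = p - 1 by ring.
  by rewrite addrK cb cc !c0 ?subr0 ?addr0//; lia.
Qed.

Lemma tracks_step (R : realType) (o : int) (x : nat -> int) (n : nat)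
    (st : state) (right : bool) : tracks R o x n st ->
  x n.+1 = x n + (if right then 1 else - 1) ->
  tracks R o x n.+1 (step R st right).
Proof.
case: st => // k y s z a b c [xn nn c0 [cz ca cb cc]] xS.
(* [q] is the left end of the edge just crossed. *)
have [q qE cS] : exists2 q, q = x n - (~~ right)%:Z &
    forall j, crossings R x n.+1 j = crossings R x n j + (j == q)%:R.
  exists (x n - (~~ right)%:Z) => // j.
  case: right xS => xS; last exact: crossings_left.
  by rewrite subr0; apply: crossings_right.
case: k right xS qE xn => -[]// xS qE xn; rewrite /= in xn qE *.
- split; rewrite ?xS ?xn/=; [lia|lia| |].
    by move=> j pj; rewrite cS c0// (_ : _ == _ = false) ?addr0// qE xn /=; lia.
  by rewrite !cS cz ca cb cc -!natrD; split; congr (_%:R); rewrite qE xn /=; lia.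
- have Y : y.+1%:Z + o = y%:Z + o + 1 by lia.
  rewrite /enter_right; case: eqP => [e|_]; first case: ifP => // _.
    split; rewrite ?Y; [by rewrite xS xn /=; lia|by lia| |].
      move=> j pj; have pj' : y%:Z + o < j by lia.
      by rewrite cS c0// (_ : _ == _ = false) ?addr0// qE xn /=; lia.
    rewrite !cS (_ : _ + 1 - 3 = y%:Z + o - 2); last by lia.
    rewrite (_ : _ + 1 - 2 = y%:Z + o - 1); last by lia.
    rewrite addrK (c0 (_ + 1)) ?ltrDl// ca cb cc -[0]/(0%:R) -!natrD.
    by split; congr (_%:R); rewrite qE xn /=; lia.
  split; rewrite ?xS ?xn/=; [lia|lia| |].
    by move=> j pj; rewrite cS c0// (_ : _ == _ = false) ?addr0// qE xn /=; lia.
  by rewrite !cS cz ca cb cc -!natrD; split; congr (_%:R); rewrite qE xn /=; lia.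
- case: ifP => // _; split; rewrite ?xS ?xn/=; [lia|lia| |].
    by move=> j pj; rewrite cS c0// (_ : _ == _ = false) ?addr0// qE xn /=; lia.
  by rewrite !cS cz ca cb cc -!natrD; split; congr (_%:R); rewrite qE xn /=; lia.
- split; rewrite ?xS ?xn/=; [lia|lia| |].
    by move=> j pj; rewrite cS c0// (_ : _ == _ = false) ?addr0// qE xn /=; lia.
  by rewrite !cS cz ca cb cc -!natrD; split; congr (_%:R); rewrite qE xn /=; lia.
Qed.

(** Defined on arbitrary sequences: any jump other than +1 or -1 kills the run. *)
Fixpoint run (R : realType) (st0 : state) (x : nat -> int) (n0 N : nat) : state :=
  if N is M.+1 then
    let st := run R st0 x n0 M in
    if x (n0 + N)%N == x (n0 + M)%N + 1 then step R st true
    else if x (n0 + N)%N == x (n0 + M)%N - 1 then step R st false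
    else Dead
  else st0.

Lemma run_consistent (R : realType) (st0 : state) (x : nat -> int) (n0 N : nat) :
  consistent R st0 -> consistent R (run R st0 x n0 N).
Proof.
move=> c0; elim: N => [//|N IH] /=.
by do 2?[case: ifP => _]; rewrite ?step_consistent//; apply: step_consistent.
Qed.

Lemma run_tracks (R : realType) (o : int) (st0 : state) (x : nat -> int)
    (n0 N : nat) :
  tracks R o x n0 st0 -> tracks R o x (n0 + N) (run R st0 x n0 N).
Proof.
move=> t0; elim: N => [|N IH]; first by rewrite addn0.
rewrite addnS /= addnS; case: eqP => [xS|_]; first exact: tracks_step.
by case: eqP => [xS|_]//; apply: tracks_step.
Qed.

(** * Dependence on finite prefixes *)

Lemma local_time_ext (R : realType) (L0 : rat -> R) (x x' : nat -> int) (n : nat) :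
  (forall k, (k <= n)%N -> x k = x' k) ->
  local_time L0 x n = local_time L0 x' n.
Proof.
elim: n => [//|n IH] xx' /=; rewrite IH ?xx'// => k kn.
by apply/xx'/leqW.
Qed.

Lemma Delta_ext (R : realType) (L0 : rat -> R) (x x' : nat -> int) (n : nat) :
  (forall k, (k <= n)%N -> x k = x' k) -> Delta L0 x n = Delta L0 x' n.
Proof.
by move=> xx'; rewrite /Delta /seen_local_time (local_time_ext _ xx') xx'.
Qed.

Lemma run_ext (R : realType) (st0 : state) (x x' : nat -> int) (n0 N : nat) :
  (forall k, (k <= n0 + N)%N -> x k = x' k) ->
  run R st0 x n0 N = run R st0 x' n0 N.
Proof.
elim: N => [//|N IH] xx' /=; rewrite IH ?xx' ?leq_add2l// => k kn.
by apply: xx'; rewrite addnS leqW.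
Qed.

Lemma alive_run_le (R : realType) (st0 : state) (x : nat -> int) (n0 N M : nat) :
  (N <= M)%N -> alive (run R st0 x n0 M) -> alive (run R st0 x n0 N).
Proof.
move=> /subnKC <-; elim: (M - N)%N => [|k IH]; first by rewrite addn0.
rewrite addnS => h; apply: IH; move: h => /=.
by case: (run R st0 x n0 (N + k)) => //=; do 2?case: ifP.
Qed.

(** * From survival to the asymptotics *)

Definition deviation (R : realType) (y : nat) : R :=
  Num.sqrt (Num.sqrt y%:R ^+ 3).

(** Summing the final local times [i + O(i^(3/4))] gives [y^2 / 2 + O(y^(7/4))]; the linear term
    absorbs the discrete sum and [C] the start. *)
Definition balanced (R : realType) (C : R) (st : state) : Prop :=
  if st is Live k y s z a b c then
    `|s%:R - y%:R ^+ 2 / 2| <= y%:R * deviation R y + y%:R + C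
  else True.

Lemma balanced_step (R : realType) (C : R) (st : state) (right : bool) :
  balanced C st -> balanced C (step R st right).
Proof.
case: st => // k y s z a b c; case: k; case: right => //= H; last by case: ifP.
rewrite /enter_right; case: ifP => // _; case: ifP => //= nb.
have t0 : 0 <= deviation R y.+1 by apply: sqrtr_ge0.
have /andP[b1 b2] : - deviation R y.+1 <= b%:R - y.+1%:R <= deviation R y.+1.
  apply: sqr_le_bounds => //.
  by rewrite sqr_sqrtr ?exprn_ge0 ?sqrtr_ge0.
have tt : deviation R y <= deviation R y.+1.
  rewrite ler_sqrt ?exprn_ge0 ?sqrtr_ge0// lerXn2r ?nnegrE ?sqrtr_ge0//.
  by rewrite ler_sqrt// ler_nat.
have : y%:R * deviation R y <= y%:R * deviation R y.+1 by rewrite ler_wpM2l.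
move: H b1 b2 tt; rewrite !ler_norml natrD -[y.+1%:R]natr1.
move=> /andP[H1 H2] b1 b2 tt h.
have -> : (y%:R + 1 : R) ^+ 2 / 2 = y%:R ^+ 2 / 2 + y%:R + 1 / 2 by field.
by apply/andP; split; lra.
Qed.

Lemma run_balanced (R : realType) (C : R) (st0 : state) (x : nat -> int)
    (n0 N : nat) : balanced C st0 -> balanced C (run R st0 x n0 N).
Proof.
move=> b0; elim: N => [//|N IH] /=.
by case: eqP => _; [exact: balanced_step|case: eqP => // _; exact: balanced_step].
Qed.

Lemma run_asymptotics (R : realType) (o : int) (C : R) (st0 : state)
    (x : nat -> int) (n0 : nat) :
  consistent R st0 -> tracks R o x n0 st0 -> balanced C st0 -> 0 <= C ->
  (forall N, alive (run R st0 x n0 N)) ->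
  exists2 B : R, 0 <= B & forall n, (n0 <= n)%N -> exists y : nat,
    [/\ (0 < y)%N, `|(x n)%:~R - y%:R| <= B
      & `|n%:R - y%:R ^+ 2 / 2| <= y%:R * deviation R y + B * y%:R].
Proof.
(* [|o| + 1] covers the position; 9 is 8 for [b + c <= 8 * y] plus 1 for the linear term of
   [balanced]. *)
move=> c0 t0 b0 C0 al; exists (`|o|%:~R + 9 + C).
  by rewrite !addr_ge0// ler0z.
move=> n /subnKC nE.
have := run_consistent x n0 (n - n0) c0; have := run_tracks (n - n0) t0.
have := run_balanced x n0 (n - n0) b0; have := al (n - n0)%N.
case: (run R st0 x n0 (n - n0)) => // k y s z a b c _ bal; rewrite nE.
case=> xn nn _ _ [ly ny zy oa [ab ba K]].
have [ay ya] := near_bounds ly ny; have y3 := large_nat ly.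
have m0 : (16 * halfwin y <= y)%N by rewrite /halfwin; lia.
have bc : (b + c <= 8 * y)%N by case: k K {xn bal} => -[]; lia.
have y1 : 1 <= y%:R :> R by rewrite ler1n; lia.
exists y; split; first by lia.
  rewrite xn !intrD [_ + o%:~R]addrC -addrA -addrA addrC -!addrA.
  have -> : y%:~R = y%:R :> R by [].
  rewrite (_ : _ + _ = o%:~R + (offset k)%:~R); last by ring.
  apply: le_trans (ler_normD _ _) _; rewrite intr_norm.
  have : `|(offset k)%:~R| <= 1 :> R.
    by case: k {K xn bal} => /=; rewrite ?normrN ?normr0 ?normr1.
  move: C0; lra.
move: bal => /=; rewrite nn -addnA natrD !ler_norml => /andP[h1 h2].
move: bc; rewrite -(ler_nat R) natrM => bc.
have bc0 : 0 <= (b + c)%:R :> R by [].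
have o0 : 0 <= `|o|%:~R * y%:R :> R by rewrite mulr_ge0// ler0z.
have Cy : C <= C * y%:R by rewrite ler_peMr.
have E : (`|o|%:~R + 9 + C) * y%:R = `|o|%:~R * y%:R + 9 * y%:R + C * y%:R :> R.
  by ring.
by rewrite E; apply/andP; split; lra.
Qed.

Lemma asymptotics_cvg (R : realType) (x : nat -> int) (n0 : nat) (B : R) :
  0 <= B ->
  (forall n, (n0 <= n)%N -> exists y : nat,
    [/\ (0 < y)%N, `|(x n)%:~R - y%:R| <= B
      & `|n%:R - y%:R ^+ 2 / 2| <= y%:R * deviation R y + B * y%:R]) ->
  (fun n : nat => (x n)%:~R / Num.sqrt (2 * n%:R) : R) @ \oo --> (1 : R).
Proof.
move=> B0 H; apply/cvgrPdist_le => e' e'0.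
pose e := Num.min e' 1.
have e0 : 0 < e by rewrite lt_min e'0 ltr01.
have e1 : e <= 1 by rewrite ge_min lexx orbT.
(* For [y >= Y] the three main terms give [deviation y <= e * y / 8], [4 * B + B^2 <= e * y / 4] and
   [x n >= 0]. *)
pose Y := (64 / e ^+ 2) ^+ 2 + 4 * (4 * B + B ^+ 2) / e + B + 1.
have Y1 : (64 / e ^+ 2) ^+ 2 <= Y.
  rewrite /Y -!addrA lerDl !addr_ge0// divr_ge0 ?(ltW e0)// mulr_ge0//.
  by rewrite addr_ge0 ?mulr_ge0 ?exprn_ge0.
have Y2 : 4 * (4 * B + B ^+ 2) / e <= Y.
  rewrite /Y -!addrA addrCA lerDl !addr_ge0// exprn_ge0// divr_ge0//.
  by rewrite exprn_ge0 ?(ltW e0).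
have Y3 : B + 1 <= Y.
  rewrite /Y -[leRHS]addrA lerDr addr_ge0// ?exprn_ge0//.
    by rewrite divr_ge0 ?exprn_ge0 ?(ltW e0).
  by rewrite divr_ge0 ?(ltW e0)// mulr_ge0// addr_ge0 ?mulr_ge0 ?exprn_ge0.
near=> n.
have nn0 : (n0 <= n)%N by near: n; exact: nbhs_infty_ge.
(* If [y < Y], then [n] would be at most [(2 + B) * Y^2]. *)
have nY : (2 + B) * Y ^+ 2 < n%:R by near: n; exact: nbhs_infty_gtr.
have [y [y0 xy ny]] := H n nn0.
have {}y0 : 1 <= y%:R :> R by rewrite ler1n.
pose r : R := Num.sqrt y%:R.
have r2 : r ^+ 2 = y%:R by rewrite sqr_sqrtr.
have r1 : 1 <= r by rewrite -(@ler_pXn2r _ 2) ?nnegrE ?sqrtr_ge0// r2 expr1n.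
have t2 : deviation R y ^+ 2 = r ^+ 3 by rewrite sqr_sqrtr ?exprn_ge0 ?sqrtr_ge0.
have t0 : 0 <= deviation R y by apply: sqrtr_ge0.
have ty : deviation R y <= y%:R.
  rewrite -(@ler_pXn2r _ 2) ?nnegrE// t2 -r2 -exprM.
  by rewrite ler_weXn2l.
have [n1 n2] : n%:R <= y%:R ^+ 2 / 2 + y%:R * deviation R y + B * y%:R /\
    y%:R ^+ 2 / 2 - y%:R * deviation R y - B * y%:R <= n%:R.
  by move: ny; rewrite ler_norml => /andP[? ?]; split; lra.
have Yy : Y <= y%:R.
  rewrite leNgt; apply/negP => yY.
  have : y%:R ^+ 2 <= Y ^+ 2 by rewrite ler_sqr ?nnegrE; lra.
  have : y%:R * deviation R y <= y%:R ^+ 2 by rewrite expr2 ler_wpM2l.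
  have : B * y%:R <= B * y%:R ^+ 2.
    by rewrite ler_wpM2l// expr2 ler_peMl//; lra.
  move=> h1 h2 h3.
  have : (2 + B) * y%:R ^+ 2 <= (2 + B) * Y ^+ 2 by rewrite ler_wpM2l//; lra.
  have : 0 <= y%:R ^+ 2 :> R by rewrite sqr_ge0.
  by move: n1 nY h1 h2 h3; clear; rewrite !mulrDl; lra.
have te : deviation R y <= e * y%:R / 8.
  rewrite -(@ler_pXn2r _ 2) ?nnegrE ?divr_ge0 ?mulr_ge0 ?(ltW e0)// t2 -r2.
  have -> : (e * r ^+ 2 / 8) ^+ 2 = r ^+ 3 * (e ^+ 2 * r / 64) by field.
  rewrite ler_peMr ?exprn_ge0//; first by lra.
  rewrite ler_pdivlMr// mul1r mulrC -ler_pdivrMr ?exprn_gt0//.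
  rewrite -(@ler_pXn2r _ 2) ?nnegrE ?divr_ge0 ?exprn_ge0 ?(ltW e0)//; lra.
have Be : 4 * B + B ^+ 2 <= e * y%:R / 4.
  have : 4 * (4 * B + B ^+ 2) / e <= y%:R by lra.
  by rewrite ler_pdivrMr//; lra.
have xge0 : 0 <= (x n)%:~R :> R.
  by move: xy; rewrite ler_norml => /andP[? ?]; lra.
pose X : R := (x n)%:~R; rewrite -/X in xy xge0 *.
have d1 : `|X ^+ 2 - y%:R ^+ 2| <= B * (2 * y%:R + B).
  rewrite subr_sqr normrM ler_pM//.
  move: xy; rewrite !ler_norml => /andP[? ?]; apply/andP; split; lra.
have d2 : B * (2 * y%:R + B) <= (2 * B + B ^+ 2) * y%:R.
  have : B ^+ 2 <= B ^+ 2 * y%:R by rewrite ler_peMr ?exprn_ge0.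
  by lra.
have d3 : `|X ^+ 2 - 2 * n%:R| <=
    2 * y%:R * deviation R y + (4 * B + B ^+ 2) * y%:R.
  move: d1; rewrite !ler_norml => /andP[? ?].
  have -> : (4 * B + B ^+ 2) * y%:R = (2 * B + B ^+ 2) * y%:R + 2 * (B * y%:R).
    by ring.
  apply/andP; split; lra.
have d4 : 2 * y%:R * deviation R y + (4 * B + B ^+ 2) * y%:R
    <= e * y%:R ^+ 2 / 2.
  have : y%:R * deviation R y <= y%:R * (e * y%:R / 8) by rewrite ler_wpM2l.
  have : y%:R * (4 * B + B ^+ 2) <= y%:R * (e * y%:R / 4) by rewrite ler_wpM2l.
  have -> : e * y%:R ^+ 2 / 2 = 2 * (y%:R * (e * y%:R / 8)) + y%:R * (e * y%:R / 4).
    by field.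
  rewrite [y%:R * (4 * B + _)]mulrC; lra.
have y20 : 0 < y%:R ^+ 2 :> R by rewrite exprn_gt0//; lra.
have ey2 : e * y%:R ^+ 2 <= y%:R ^+ 2 by rewrite ler_piMl// ltW.
have n3 : y%:R ^+ 2 / 2 <= 2 * n%:R :> R.
  have : 0 <= B ^+ 2 * y%:R by rewrite mulr_ge0 ?exprn_ge0.
  move: d4; have -> : (4 * B + B ^+ 2) * y%:R = 4 * (B * y%:R) + B ^+ 2 * y%:R by ring.
  have : 0 <= B * y%:R by rewrite mulr_ge0.
  by move: n2 ey2; clear; lra.
have n0' : 0 < 2 * n%:R :> R by lra.
pose q := X / Num.sqrt (2 * n%:R).
have q0 : 0 <= q by rewrite divr_ge0 ?sqrtr_ge0.
have q2 : q ^+ 2 = X ^+ 2 / (2 * n%:R).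
  by rewrite expr_div_n sqr_sqrtr// ltW.
(* As [q + 1 >= 1], it suffices to compare squares, [X^2] with [2 * n]. *)
rewrite -/q distrC; apply: (@le_trans _ _ `|q ^+ 2 - 1|).
  rewrite -[1 in leRHS](expr1n _ 2) subr_sqr normrM ler_peMr//.
  by rewrite ger0_norm; lra.
rewrite q2 (_ : _ - 1 = (X ^+ 2 - 2 * n%:R) / (2 * n%:R)); last first.
  by field; move: n0'; rewrite pmulr_rgt0// => /gt_eqF ->.
rewrite normrM normfV [`|2 * _|]gtr0_norm// ler_pdivrMr//.
apply: le_trans d3 _; apply: le_trans d4 _.
apply: (@le_trans _ _ (e * (2 * n%:R))); last first.
  by rewrite ler_wpM2r ?(ltW n0')// ge_min lexx.
by rewrite -mulrA ler_wpM2l// ltW.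
Unshelve. all: by end_near.
Qed.

(** * Cylinder probabilities and the survival bound *)

Definition cylinder (d : measure_display) (T : measurableType d) (R : realType)
    (P : probability T R) (X : nat -> {RV P >-> int}) (h : nat -> int)
    (n : nat) : set T :=
  [set w | forall k, (k <= n)%N -> X k w = h k].

Lemma cylinder_bigcap (d : measure_display) (T : measurableType d) (R : realType)
    (P : probability T R) (X : nat -> {RV P >-> int}) (h : nat -> int) (n : nat) :
  cylinder X h n =
    \bigcap_k (if (k <= n)%N then X k @^-1` [set h k] else setT).
Proof.
apply/seteqP; split => w /= H.
  by move=> k _; case: ifP => // kn; apply: H.
by move=> k kn; have := H k I; rewrite kn.
Qed.

Lemma measurable_cylinder (d : measure_display) (T : measurableType d)
    (R : realType) (P : probability T R) (X : nat -> {RV P >-> int})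
    (h : nat -> int) (n : nat) : measurable (cylinder X h n).
Proof.
rewrite cylinder_bigcap; apply: bigcap_measurableType => k _.
case: ifP => // _; rewrite -[X in measurable X]setTI.
exact: measurable_funP.
Qed.

Lemma past_cylinder (d : measure_display) (T : measurableType d)
    (R : realType) (P : probability T R) (X : nat -> {RV P >-> int})
    (h : nat -> int) (n : nat) : past X n (cylinder X h n).
Proof.
rewrite cylinder_bigcap /past /g_sigma_preimage.
set G := \big[setU/set0]_(i < n.+1) _.
apply: (@bigcap_measurableType _ (g_sigma_algebraType G)) => k _.
case: ifP => [kn|_]; last exact: (@measurableT _ (g_sigma_algebraType G)).
apply: sub_sigma_algebra; rewrite /G (bigD1 (Ordinal (kn : (k < n.+1)%N)))//=.
by left; exists [set h k] => //; rewrite setTI.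
Qed.

(** Finite integer sequences are countable, so the event is a countable union of cylinders. *)
Lemma measurable_prefix (d : measure_display) (T : measurableType d)
    (R : realType) (P : probability T R) (X : nat -> {RV P >-> int})
    (Q : (nat -> int) -> Prop) (n : nat) :
  (forall x x', (forall k, (k <= n)%N -> x k = x' k) -> Q x -> Q x') ->
  measurable [set w | Q (fun k => X k w)].
Proof.
move=> Qext.
have -> : [set w | Q (fun k => X k w)] = \bigcup_(s in [set: seq int])
    (if `[< Q (nth 0 s) >] then cylinder X (nth 0 s) n else set0).
  apply/seteqP; split => w /=.
    move=> Qw; exists (mkseq (fun k => X k w) n.+1) => //.
    rewrite asboolT => [k kn|]; first by rewrite nth_mkseq.
    by apply: Qext Qw => k kn; rewrite nth_mkseq.
  by move=> [s _]; case: asboolP => // Qs sw; apply: Qext Qs => k /sw.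
apply: countable_bigcupT_measurable => [|s]; first exact: countableP.
by case: asboolP => // _; apply: measurable_cylinder.
Qed.

Definition extend (h : nat -> int) (n : nat) (v : int) : nat -> int :=
  fun k => if (k <= n)%N then h k else v.

Lemma extend_le (h : nat -> int) (n : nat) (v : int) (k : nat) :
  (k <= n)%N -> extend h n v k = h k.
Proof. by rewrite /extend => ->. Qed.

Lemma extendS (h : nat -> int) (n : nat) (v : int) : extend h n v n.+1 = v.
Proof. by rewrite /extend ltnn. Qed.

Lemma cylinder_ext (d : measure_display) (T : measurableType d)
    (R : realType) (P : probability T R) (X : nat -> {RV P >-> int})
    (h h' : nat -> int) (n : nat) :
  (forall k, (k <= n)%N -> h k = h' k) -> cylinder X h n = cylinder X h' n.
Proof.
by move=> hh'; apply/seteqP; split => w Xw k kn; rewrite Xw// hh'.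
Qed.

(** The cylinder belongs to the past and the conditional probability is constant on it, so the
    defining integral is a product. *)
Lemma cond_prob_cylinder (d : measure_display) (T : measurableType d)
    (R : realType) (P : probability T R) (X : nat -> {RV P >-> int})
    (h : nat -> int) (n : nat) (v : int) (F : (nat -> int) -> R) :
  (forall x x', (forall k, (k <= n)%N -> x k = x' k) -> F x = F x') ->
  h n.+1 = h n + v ->
  is_cond_prob P (past X n) [set w | X n.+1 w = X n w + v]
    (fun w => F (fun k => X k w)) ->
  (P (cylinder X h n.+1) = (F h)%:E * P (cylinder X h n))%E.
Proof.
move=> Fext hS [_ _ cp].
have -> : cylinder X h n.+1 =
    [set w | X n.+1 w = X n w + v] `&` cylinder X h n.
  apply/seteqP; split => [w Xw|w [XS Xw] k].
    by split=> [|k kn]; [rewrite /= !Xw|apply: Xw; apply: leqW].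
  rewrite leq_eqVlt => /predU1P[->|]; last exact: Xw.
  by rewrite XS Xw// hS.
rewrite cp; last exact: past_cylinder.
rewrite -integral_cst; last exact: measurable_cylinder.
apply: eq_integral => w; rewrite inE => Xw; congr EFin; exact: Fext.
Qed.

Lemma tracks_ext (R : realType) (o : int) (x x' : nat -> int) (n : nat)
    (st : state) : (forall k, (k <= n)%N -> x k = x' k) ->
  tracks R o x n st -> tracks R o x' n st.
Proof.
move=> xx'; rewrite /tracks /crossings (local_time_ext _ xx').
by rewrite (xx' n).
Qed.

Lemma cylinder_right (d : measure_display) (T : measurableType d)
    (R : realType) (P : probability T R) (X : nat -> {RV P >-> int})
    (hright : forall n : nat,
      is_cond_prob P (past X n) [set w | X n.+1 w = X n w + 1]
        (fun w => right_prob (Delta (cst 0) (fun k => X k w) n)))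
    (h : nat -> int) (n : nat) : h n.+1 = h n + 1 ->
  (P (cylinder X h n.+1)
   = (right_prob (Delta (cst 0) h n))%:E * P (cylinder X h n))%E.
Proof.
move=> hS.
apply: (@cond_prob_cylinder _ _ _ _ _ _ _ 1
  (fun x => right_prob (Delta (cst 0) x n))) => // x x' xx'.
by rewrite (Delta_ext _ xx').
Qed.

Lemma cylinder_left (d : measure_display) (T : measurableType d)
    (R : realType) (P : probability T R) (X : nat -> {RV P >-> int})
    (hleft : forall n : nat,
      is_cond_prob P (past X n) [set w | X n.+1 w = X n w - 1]
        (fun w => 1 - right_prob (Delta (cst 0) (fun k => X k w) n)))
    (h : nat -> int) (n : nat) : h n.+1 = h n - 1 ->
  (P (cylinder X h n.+1)
   = (1 - right_prob (Delta (cst 0) h n))%:E * P (cylinder X h n))%E.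
Proof.
move=> hS.
apply: (@cond_prob_cylinder _ _ _ _ _ _ _ (- 1)
  (fun x => 1 - right_prob (Delta (cst 0) x n))) => // x x' xx'.
by rewrite (Delta_ext _ xx').
Qed.

Lemma measurable_alive (d : measure_display) (T : measurableType d)
    (R : realType) (P : probability T R) (X : nat -> {RV P >-> int})
    (st0 : state) (n0 N : nat) :
  measurable [set w | alive (run R st0 (fun k => X k w) n0 N)].
Proof.
apply: (@measurable_prefix _ _ _ _ _
  (fun x => alive (run R st0 x n0 N)) (n0 + N)) => x x' xx'.
by rewrite (run_ext R st0 xx').
Qed.

(** Induction on the horizon [M] for all prefixes [h]: the bounds for the two continuations of [h]
    are averaged by the supermartingale inequality. For [M = 0], the potential is nonnegative, and 1
    at death. *)
Lemma survival_ge (d : measure_display) (T : measurableType d)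
    (R : realType) (P : probability T R) (X : nat -> {RV P >-> int})
    (hright : forall n : nat,
      is_cond_prob P (past X n) [set w | X n.+1 w = X n w + 1]
        (fun w => right_prob (Delta (cst 0) (fun k => X k w) n)))
    (hleft : forall n : nat,
      is_cond_prob P (past X n) [set w | X n.+1 w = X n w - 1]
        (fun w => 1 - right_prob (Delta (cst 0) (fun k => X k w) n)))
    (o : int) (st0 : state) (n0 : nat) (M N : nat) (h : nat -> int) :
  consistent R st0 -> tracks R o h n0 st0 ->
  ((1 - potential R (run R st0 h n0 N))%:E * P (cylinder X h (n0 + N))
   <= P (cylinder X h (n0 + N) `&`
         [set w | alive (run R st0 (fun k => X k w) n0 (N + M))]))%E.
Proof.
move=> c0; elim: M N h => [|M IH] N h t0.
  case E : (alive (run R st0 h n0 N)); last first.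
    by case: (run R st0 h n0 N) E => //= _; rewrite subrr mul0e measure_ge0.
  rewrite (_ : _ `&` _ = cylinder X h (n0 + N)); last first.
    apply/setIidPl => w Xw /=; rewrite addn0.
    by rewrite (@run_ext R st0 _ h).
  rewrite -[leRHS]mul1e lee_wpmul2r ?measure_ge0// lee_fin gerBl.
  exact/potential_ge0/run_consistent.
case E : (alive (run R st0 h n0 N)); last first.
  by case: (run R st0 h n0 N) E => //= _; rewrite subrr mul0e measure_ge0.
set n := (n0 + N)%N; set st := run R st0 h n0 N in E *.
have c : consistent R st by exact: run_consistent.
have D : Delta (cst 0) h n = drift R st by apply: tracks_drift (run_tracks N t0) E.
pose hr := extend h n (h n + 1); pose hl := extend h n (h n - 1).
have hrE k : (k <= n)%N -> hr k = h k by exact: extend_le.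
have hlE k : (k <= n)%N -> hl k = h k by exact: extend_le.
have hrS : hr n.+1 = h n + 1 by exact: extendS.
have hlS : hl n.+1 = h n - 1 by exact: extendS.
have n0n : (n0 <= n)%N by exact: leq_addr.
have tr : tracks R o hr n0 st0.
  by apply: tracks_ext t0 => k kn; rewrite hrE//; apply: leq_trans n0n.
have tl : tracks R o hl n0 st0.
  by apply: tracks_ext t0 => k kn; rewrite hlE//; apply: leq_trans n0n.
have Nn : (n0 + N.+1)%N = n.+1 by rewrite addnS.
have rr : run R st0 hr n0 N.+1 = step R st true.
  by rewrite /= Nn -/n hrS hrE// eqxx (@run_ext R st0 _ h).
have rl : run R st0 hl n0 N.+1 = step R st false.
  rewrite /= Nn -/n hlS hlE// (@run_ext R st0 _ h)// eqxx.
  by rewrite (_ : _ == _ = false)//; lia.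
have := IH N.+1 hr tr; have := IH N.+1 hl tl; rewrite rr rl Nn !addSnnS.
set S := [set w | _].
rewrite (@cylinder_right _ _ _ _ _ hright hr n); last by rewrite hrS hrE.
rewrite (@cylinder_left _ _ _ _ _ hleft hl n); last by rewrite hlS hlE.
rewrite (cylinder_ext X hrE) (cylinder_ext X hlE).
rewrite (Delta_ext _ hrE) (Delta_ext _ hlE) D.
have mS : measurable S by exact: measurable_alive.
have mc x k : measurable (cylinder X x k `&` S).
  by apply: measurableI => //; apply: measurable_cylinder.
(* An inclusion is enough for a lower bound. *)
have sub : (cylinder X hr n.+1 `&` S) `|` (cylinder X hl n.+1 `&` S)
    `<=` cylinder X h n `&` S.
  by move=> w [] [Xw Sw]; split => // k kn;
     rewrite (Xw k (leqW kn)) (hrE, hlE).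
have disj : (cylinder X hr n.+1 `&` S) `&` (cylinder X hl n.+1 `&` S) = set0.
  apply/seteqP; split => // w [[/(_ _ (leqnn _)) + _] [/(_ _ (leqnn _)) + _]].
  by rewrite hrS hlS => -> ?; lia.
move=> Hl Hr.
apply: le_trans (le_measure P _ _ sub); rewrite ?inE//; last exact: measurableU.
rewrite [leRHS]measureU//.
apply: le_trans (leeD Hr Hl).
have [q Pq] : exists q, P (cylinder X h n) = q%:E.
  exists (fine (P (cylinder X h n))); rewrite fineK//.
  by apply: fin_num_measure; apply: measurable_cylinder.
have q0 : 0 <= q by rewrite -lee_fin -Pq measure_ge0.
rewrite Pq; have := potential_supermartingale c E; set p := right_prob _.
set u := potential R (step _ _ _); set v := potential R (step _ _ _).
move: p u v (potential R st) => p u v w uvw.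
rewrite -!EFinM -EFinD lee_fin !mulrA -mulrDl ler_wpM2r//; lra.
Qed.

(** * The start of the path *)

(* For odd a, the walk oscillates on {0, 1} for a steps and on {1, 2} afterwards. *)
Definition warmup (a n : nat) : int :=
  if (n <= a)%N then (odd n)%:Z else 1 + (odd (n - a))%:Z.

Lemma warmup_add (a j : nat) : odd a -> warmup a (a + j) = 1 + (odd j)%:Z.
Proof.
case: j => [|j] oa; first by rewrite addn0 /warmup leqnn oa.
by rewrite /warmup addKn leqNgt -addSnnS leq_addr.
Qed.

Lemma warmup_crossings_fst (R : realType) (a n : nat) (k : int) : (n <= a)%N ->
  crossings R (warmup a) n k = ((k == 0) * n)%:R.
Proof.
elim: n => [|n IH] na; first by rewrite muln0.
have xn : warmup a n = (odd n)%:Z by rewrite /warmup (ltnW na).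
have xS : warmup a n.+1 = (~~ odd n)%:Z by rewrite /warmup na.
rewrite mulnS addnC natrD -IH ?(ltnW na)//; case on : (odd n) xn xS => xn xS.
  by rewrite crossings_left ?xS ?xn// subrr.
by rewrite crossings_right ?xS ?xn.
Qed.

Lemma warmup_crossings (R : realType) (a j : nat) (k : int) : odd a ->
  crossings R (warmup a) (a + j) k = ((k == 0) * a + (k == 1) * j)%:R.
Proof.
move=> oa; elim: j => [|j IH].
  by rewrite muln0 !addn0 warmup_crossings_fst.
have xn := warmup_add j oa; have := warmup_add j.+1 oa; rewrite addnS /= => xS.
have -> : ((k == 0) * a + (k == 1) * j.+1
           = (k == 0) * a + (k == 1) * j + (k == 1))%N.
  by rewrite mulnS addnCA addnC.
rewrite natrD -IH.
case on : (odd j) xn xS => xn xS.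
  by rewrite crossings_left ?xS ?xn//= addrK.
by rewrite crossings_right ?xS ?xn.
Qed.

Lemma warmup_step (a n : nat) : odd a ->
  warmup a n.+1 = warmup a n + 1 \/ warmup a n.+1 = warmup a n - 1.
Proof.
move=> oa; case: (leqP a n) => [/subnKC <-|na].
  rewrite -addnS !warmup_add//=; case: (odd _); [right|left]; lia.
by rewrite /warmup na (ltnW na) /=; case: (odd n); [right|left]; lia.
Qed.

(** Every step goes to a neighbour, and both directions always have positive conditional
    probability. *)
Lemma warmup_gt0 (d : measure_display) (T : measurableType d)
    (R : realType) (P : probability T R) (X : nat -> {RV P >-> int})
    (hX0 : {ae P, forall w, X 0%N w = 0})
    (hright : forall n : nat,
      is_cond_prob P (past X n) [set w | X n.+1 w = X n w + 1]
        (fun w => right_prob (Delta (cst 0) (fun k => X k w) n)))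
    (hleft : forall n : nat,
      is_cond_prob P (past X n) [set w | X n.+1 w = X n w - 1]
        (fun w => 1 - right_prob (Delta (cst 0) (fun k => X k w) n)))
    (a n : nat) : odd a -> (0 < P (cylinder X (warmup a) n))%E.
Proof.
move=> oa; elim: n => [|n IH].
  have m0 := measurable_cylinder X (warmup a) 0.
  have N0 : P (~` cylinder X (warmup a) 0) = 0%E.
    apply/negligibleP; first exact: measurableC.
    apply: negligibleS hX0 => w /= H X0; apply: H => k.
    by rewrite leqn0 => /eqP ->.
  by rewrite -[cylinder _ _ _]setCK probability_setC ?N0 ?sube0//; apply: measurableC.
case: (warmup_step n oa) => xS.
  rewrite (@cylinder_right _ _ _ _ _ hright _ _ xS) mule_gt0//.
  by rewrite lte_fin right_prob_gt0.
rewrite (@cylinder_left _ _ _ _ _ hleft _ _ xS) mule_gt0//.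
by rewrite lte_fin -right_probN right_prob_gt0.
Qed.

(** * Measurability of the event, and conclusion *)

Lemma measurable_ratio_cvg (d : measure_display) (T : measurableType d)
    (R : realType) (P : probability T R) (X : nat -> {RV P >-> int})
    (u : nat -> R) (l : R) :
  measurable [set w | (fun n : nat => (X n w)%:~R / u n : R) @ \oo --> l].
Proof.
have -> : [set w | (fun n : nat => (X n w)%:~R / u n : R) @ \oo --> l] =
    \bigcap_k \bigcup_N \bigcap_(n in [set n | (N <= n)%N])
      (X n @^-1` [set z | `|l - z%:~R / u n| <= k.+1%:R^-1]).
  apply/seteqP; split => w /=.
    move=> /cvgrPdist_le cv k _.
    have /cv : 0 < k.+1%:R^-1 :> R by rewrite invr_gt0 ltr0n.
    by move=> [N _ HN]; exists N => // n Nn; apply: HN.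
  move=> H; apply/cvgrPdist_le => e e0.
  have [N _ HN] := H (Num.bound e^-1) I.
  exists N => // n Nn; apply: le_trans (HN n Nn) _.
  rewrite -[leRHS]invrK lef_pV2 ?posrE ?invr_gt0 ?ltr0n//.
  have := archi_boundP (ltW (etrans (invr_gt0 e) e0)).
  by move=> /ltW/le_trans; apply; rewrite ler_nat.
apply: bigcap_measurableType => k _; apply: bigcup_measurable => N _.
apply: bigcap_measurableType => n _; rewrite -[X in measurable X]setTI.
exact: measurable_funP.
Qed.

Theorem proposition4 (R : realType) (d : measure_display)
    (T : measurableType d) (P : probability T R) (X : nat -> {RV P >-> int})
    (hX0 : {ae P, forall w, X 0%N w = 0})
    (hright : forall n : nat,
      is_cond_prob P (past X n) [set w | X n.+1 w = X n w + 1]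
        (fun w => right_prob (Delta (cst 0) (fun k => X k w) n)))
    (hleft : forall n : nat,
      is_cond_prob P (past X n) [set w | X n.+1 w = X n w - 1]
        (fun w => 1 - right_prob (Delta (cst 0) (fun k => X k w) n))) :
  (0 < P [set w |
    ((fun n : nat => (X n w)%:~R / Num.sqrt (2 * n%:R) : R) @ \oo --> (1 : R))%R])%E.
Proof.
have [K oK lK] : exists2 K, odd K & large R K.
  pose N := Num.bound (2 ^+ 25 : R).
  exists N.*2.+1; first by rewrite /= odd_double.
  apply: le_trans (ltW (archi_boundP (exprn_ge0 25 (ler0n R 2)))) _.
  by rewrite ler_nat -/N -addnn leqW// leq_addr.
have K3 := large_nat lK.
(* After [K] crossings of {0, 1} and [K - 2 * m] of {1, 2}, the walker is at 2 with drift [2 * m],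
   where a window opens. Calling this site [K], so that [o = 2 - K], makes the square in [pot_start]
   vanish. *)
pose m := halfwin K; pose b := (K - m.*2)%N; pose n0 := (K + b)%N.
pose st0 := Live Mid K K 0 K b 0; pose o : int := 2 - K%:Z.
have mK : (16 * m <= K)%N by rewrite /m /halfwin; lia.
have nK : near R K K by rewrite /near subrr expr0n exprn_ge0 ?sqrtr_ge0.
have c0 : consistent R st0.
  have m1 : (16 * halfwin K.+1 <= K + 1)%N by rewrite /halfwin; lia.
  by split => //; split; rewrite -/m /b; try split; lia.
have tr x : (forall k, (k <= n0)%N -> x k = warmup K k) -> tracks R o x n0 st0.
  move=> xw; apply: (@tracks_ext _ _ (warmup K)) => [k kn|]; first by rewrite xw.
  have o2 : K%:Z + o = 2 by rewrite /o; lia.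
  rewrite /= o2; split.
  - by rewrite /n0 warmup_add// /b; lia.
  - by rewrite addn0.
  - by move=> j j2; rewrite warmup_crossings// (_ : (_ + _)%N = 0%N)//; lia.
  - by rewrite !warmup_crossings//; split; congr (_%:R); lia.
pose C : R := `|K%:R - K%:R ^+ 2 / 2|.
have bal : balanced C st0.
  by rewrite /= lerDr addr_ge0// mulr_ge0// sqrtr_ge0.
have pot1 : potential R st0 < 1.
  have := pot_start lK nK; rewrite subrr expr0n mul0r add0r.
  have -> : potential R st0 = pot R K b m.*2.+1 b.
    by rewrite /= addn0; congr pot; rewrite /remaining -/m /b; lia.
  (* What remains is [26 / sqrt K < 1], true since [26^2 = 676 < 1000 <= K]. *)
  move=> /le_lt_trans; apply; rewrite ltr_pdivrMr ?sqrtr_gt0 ?ltr0n; last by lia.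
  rewrite mul1r -(@ltr_pXn2r _ 2) ?nnegrE ?sqrtr_ge0// sqr_sqrtr//.
  by rewrite -natrX ltr_nat; lia.
pose A := cylinder X (warmup K) n0.
pose F N := A `&` [set w | alive (run R st0 (fun k => X k w) n0 N)].
have mF N : measurable (F N).
  by apply: measurableI; [exact: measurable_cylinder|exact: measurable_alive].
have mbF : measurable (\bigcap_N F N) by apply: bigcap_measurableType.
have Fdec : nonincreasing_seq F.
  move=> N M NM; apply/subsetPset => w [Aw aw]; split => //.
  exact: alive_run_le NM aw.
(* Continuity from above carries the bound, uniform in [N], over to survival at all times. *)
have cvF : P \o F @ \oo --> P (\bigcap_N F N).
  by apply: nonincreasing_cvg_mu => //; rewrite -ge0_fin_numE// fin_num_measure.
have Fge N : ((1 - potential R st0)%:E * P A <= P (F N))%E.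
  have := @survival_ge _ _ _ _ _ hright hleft o st0 n0 N 0 (warmup K) c0.
  by rewrite addn0 add0n; apply; apply: tr.
have pos : (0 < (1 - potential R st0)%:E * P A)%E.
  by rewrite mule_gt0 ?lte_fin ?subr_gt0//; apply: warmup_gt0.
have lim : ((1 - potential R st0)%:E * P A <= P (\bigcap_N F N))%E.
  rewrite -(cvg_lim _ cvF)//; apply: lime_ge.
    by apply/cvg_ex; eexists; exact: cvF.
  by apply: nearW.
apply: lt_le_trans pos (le_trans lim _); apply: le_measure; rewrite ?inE//.
  exact: measurable_ratio_cvg.
move=> w Fw /=.
have Aw : A w by have [] := Fw 0%N I.
have [B B0 HB] := run_asymptotics c0 (tr _ Aw) bal (normr_ge0 _)
  (fun N => (Fw N I).2).
exact: asymptotics_cvg B0 HB.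
Qed.
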